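(* Let $\Gamma$ be a link-regular finite simplicial graph and let $K$ be its flag completion. Then for each $0\le i\le \dim(K)$, the K-links of all $i$-simplices of $K$ have the same $f$-polynomial.
   Context: For a finite simplicial graph $\Gamma$ with vertex set $V\Gamma$, $\mathcal{A}$ is the set of non-empty subsets $\sigma\subseteq V\Gamma$ whose vertices span a complete subgraph (clique). For $\sigma\in\mathcal{A}$, $\mathrm{Lk}(\sigma)=\{v\in V\Gamma\setminus\sigma : \{v\}\cup\sigma\in\mathcal{A}\}$. The graph $\Gamma$ is link-regular if for all $\sigma\in\mathcal{A}$, $|\mathrm{Lk}(\sigma)|$ depends only on $|\sigma|$ and not on $\sigma$ itself. The flag completion (nerve) $K$ of $\Gamma$ is the abstract simplicial complex whose non-empty simplices are the elements of $\mathcal{A}$; an $i$-simplex is a clique of size $i+1$. For $\sigma\in\mathcal{A}$, the K-link of $\sigma$ is the simplicial complex $\{\tau\in K: \tau\cap\sigma=\emptyset,\ \tau\cup\sigma\in K\}$. The $f$-polynomial of a simplicial complex is $f(t)=1+f_0t+f_1t^2+\cdots$, where $f_i$ is its number of $i$-simplices. *)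

(* Defs.v *)
From mathcomp Require Import all_boot all_order all_algebra.
Set Implicit Arguments.
Unset Strict Implicit.
Unset Printing Implicit Defensive.
Import Order.TTheory GRing.Theory Num.Theory.
Local Open Scope ring_scope.

(* A finite simplicial graph is a finType V together with a symmetric and
   irreflexive adjacency relation e. *)

Definition is_clique (V : finType) (e : rel V) (s : {set V}) : bool :=
  [forall x in s, forall y in s, (x != y) ==> e x y].

Definition cliques (V : finType) (e : rel V) : {set {set V}} :=
  [set s : {set V} | (s != set0) && is_clique e s].

Definition Lk (V : finType) (e : rel V) (s : {set V}) : {set V} :=
  [set v in ~: s | v |: s \in cliques e].

Definition link_regular (V : finType) (e : rel V) : Prop :=
  forall s t : {set V}, s \in cliques e -> t \in cliques e ->
    #|s| = #|t| -> #|Lk e s| = #|Lk e t|.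

(* An abstract simplicial complex is the set of its simplices, the empty
   simplex included; the latter accounts for the constant term 1 of the
   f-polynomial. *)
Definition is_complex (V : finType) (K : {set {set V}}) : Prop :=
  set0 \in K /\ (forall s t : {set V}, t \in K -> s \subset t -> s \in K).

Definition simplices (V : finType) (K : {set {set V}}) (i : nat) :
    {set {set V}} :=
  [set s in K | #|s| == i.+1].

(* Integer-valued, so that the complex {set0} has dimension -1. *)
Definition cdim (V : finType) (K : {set {set V}}) : int :=
  (\max_(s in K) #|s|)%N%:Z - 1.

(* The sum stops at #|V| because a simplex has at most #|V| vertices. *)
Definition fpoly (V : finType) (K : {set {set V}}) : {poly int} :=
  1 + \sum_(i < #|V|) (#|simplices K i|)%:R *: 'X^(i.+1).

Definition flag_completion (V : finType) (e : rel V) : {set {set V}} :=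
  set0 |: cliques e.

Definition Klink (V : finType) (K : {set {set V}}) (s : {set V}) :
    {set {set V}} :=
  [set t in K | (t :&: s == set0) && (t :|: s \in K)].

Lemma flag_completion_complex (V : finType) (e : rel V) :
  is_complex (flag_completion e).
Proof.
split=> [|s t]; first by rewrite !inE eqxx.
rewrite !inE; case/predU1P=> [-> | /andP[_ tcl]] st.
  by move: st; rewrite subset0 => ->.
case: eqP => //= _; apply/forall_inP=> x xs; apply/forall_inP=> y ys.
exact: (forall_inP (forall_inP tcl x (subsetP st x xs)) y (subsetP st y ys)).
Qed.

Lemma Klink_complex (V : finType) (K : {set {set V}}) (s : {set V}) :
  is_complex K -> s \in K -> is_complex (Klink K s).
Proof.
move=> [K0 Kd] sK; split=> [|u t]; first by rewrite inE K0 set0I set0U eqxx.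
rewrite !inE => /and3P[tK /eqP ts tsK] ut; apply/and3P; split.
- exact: Kd tK ut.
- by rewrite -subset0 -ts setSI.
- exact: Kd tsK (setSU s ut).
Qed.

(* Main.v *)
Require Import Defs.
From mathcomp Require Import all_boot all_order all_algebra.
Set Implicit Arguments.
Unset Strict Implicit.
Unset Printing Implicit Defensive.
Import Order.TTheory GRing.Theory Num.Theory.
Local Open Scope ring_scope.

(** An ordered simplex (v_1, ..., v_j) of the K-link of a clique [s] is built
    one vertex at a time, each v_k being chosen in the link of the clique
    [s] U {v_1, ..., v_(k-1)}.  In a link-regular graph the number of choices
    at each step is a function [l] of the size of that clique only, so the
    K-link of [s] has [l n * l (n + 1) * ... * l (n + j - 1)] ordered simplices
    on [j] vertices, where [n] is the size of [s].  Every simplex has [j!]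
    orderings, so the number of simplices on [j] vertices, and hence the
    [f]-polynomial, depends on [n] alone ([card_link_faces]).  The induction
    behind this formula is the double count [double_count_link_faces] of the
    pairs formed by a simplex of the K-link and one of its vertices. *)

(** Counting by number of vertices instead of dimension includes the empty
    simplex, which is where the induction on [j] starts. *)
Definition link_faces (V : finType) (e : rel V) (s : {set V}) (j : nat) :
    {set {set V}} :=
  [set u | [&& u :&: s == set0, u :|: s \in cliques e & #|u| == j]].

Lemma sub_cliques (V : finType) (e : rel V) (s t : {set V}) :
  s != set0 -> s \subset t -> t \in cliques e -> s \in cliques e.
Proof.
move=> s0 st tc.
have tK : t \in flag_completion e by rewrite in_setU tc orbT.
have := (flag_completion_complex e).2 _ _ tK st.
by rewrite in_setU in_set1 (negPf s0).
Qed.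

Lemma simplices_Klink (V : finType) (e : rel V) (s : {set V}) (i : nat) :
  s \in cliques e ->
  simplices (Klink (flag_completion e) s) i = link_faces e s i.+1.
Proof.
move=> sc; have s0 : s != set0 by move: sc; rewrite inE => /andP[].
apply/setP=> u; rewrite [LHS]inE [u \in Klink _ _]inE [RHS]inE.
rewrite !in_setU !in_set1 setU_eq0 (negPf s0) andbF /=.
have [->|u0] := eqVneq u set0; first by rewrite cards0 !andbF.
have [uc|] := boolP (u :|: s \in cliques e); last by rewrite !andbF.
by rewrite (sub_cliques u0 (subsetUl _ _) uc) /= andbT.
Qed.

Lemma link_faces0 (V : finType) (e : rel V) (s : {set V}) :
  s \in cliques e -> link_faces e s 0 = [set set0].
Proof.
move=> sc; apply/setP=> u; rewrite [LHS]inE in_set1 cards_eq0.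
by have [->|_] := eqVneq u set0; rewrite ?andbF // set0I set0U eqxx sc.
Qed.

(** Removing [v] identifies the simplices of the K-link of [s] that contain
    [v] with the simplices of the K-link of [v |: s] that have one vertex
    fewer. *)
Lemma card_link_faces_at (V : finType) (e : rel V) (s : {set V}) (j : nat)
    (v : V) :
  v \notin s ->
  #|[set u in link_faces e s j.+1 | v \in u]| = #|link_faces e (v |: s) j|.
Proof.
move=> vs; rewrite -[RHS](card_in_imset (f := fun u => v |: u)); last first.
  move=> u w; rewrite !inE => /andP[/eqP u0 _] /andP[/eqP w0 _] uw.
  have nv (x : {set V}) : x :&: (v |: s) = set0 -> v \notin x.
    by move/setP/(_ v); rewrite !inE eqxx andbT => ->.
  by rewrite -(setU1K (nv _ u0)) uw setU1K ?nv.
apply: eq_card => u; apply/idP/imsetP.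
  case/setIdP; rewrite inE => /and3P[/eqP us uc uj] vu.
  move: uj; rewrite (cardsD1 v) vu add1n eqSS => uj.
  exists (u :\ v); last by rewrite setD1K.
  rewrite inE uj andbT setUCA setUA setD1K // uc andbT.
  apply/eqP/setP=> x; move/setP/(_ x): us; rewrite !inE.
  by have [->|] := eqVneq x v; rewrite ?vu ?(negPf vs) //=; case: (x \in u).
case=> w /setIdP[/eqP ws /andP[wc wj]] ->.
have vw : v \notin w by move/setP/(_ v): ws; rewrite !inE eqxx andbT => ->.
apply/setIdP; split; last exact: setU11.
rewrite inE cardsU1 vw add1n eqSS wj andbT -setUA setUCA wc andbT.
apply/eqP/setP=> x; move/setP/(_ x): ws; rewrite !inE.
by have [->|] := eqVneq x v; rewrite ?(negPf vs) //=; case: (x \in w).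
Qed.

Lemma mem_Lk_of_link_faces (V : finType) (e : rel V) (s u : {set V}) (j : nat)
    (v : V) :
  u \in link_faces e s j -> v \in u -> v \in Lk e s.
Proof.
rewrite inE => /and3P[/eqP us uc _] vu; apply/setIdP; split.
  by rewrite in_setC; move/setP/(_ v): us; rewrite !inE vu /= => ->.
apply: sub_cliques uc; last by rewrite setSU ?sub1set.
by apply/set0Pn; exists v; rewrite setU11.
Qed.

(** Both sides count the pairs of a simplex of the K-link of [s] on [j.+1]
    vertices and a vertex of it: by the simplex on the left, by the vertex on
    the right. *)
Lemma double_count_link_faces (V : finType) (e : rel V) (s : {set V})
    (j : nat) :
  (#|link_faces e s j.+1| * j.+1 =
   \sum_(v in Lk e s) #|link_faces e (v |: s) j|)%N.
Proof.
transitivity (\sum_(u in link_faces e s j.+1) \sum_(v in u) 1)%N.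
  rewrite -sum_nat_const; apply: eq_bigr => u.
  by rewrite sum1_card inE => /and3P[_ _ /eqP].
rewrite (exchange_big_dep (mem (Lk e s))) /=; last first.
  by move=> u v; apply: mem_Lk_of_link_faces.
apply: eq_bigr => v /setIdP[]; rewrite in_setC => vs _.
by rewrite sum1dep_card -card_link_faces_at.
Qed.

Lemma link_regular_fun (V : finType) (e : rel V) :
  link_regular e ->
  exists l : nat -> nat, forall s, s \in cliques e -> #|Lk e s| = l #|s|.
Proof.
move=> reg.
(* A size that no clique has is sent to 0. *)
exists (fun n => if [pick s in cliques e | #|s| == n] is Some s
                 then #|Lk e s| else 0%N).
move=> s sc; case: pickP => [t /andP[tc /eqP ts]|/(_ s)].
  exact: reg.
by rewrite sc eqxx.
Qed.

(** The two sides count the ordered simplices on [j] vertices in the K-link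
    of [s]. *)
Lemma card_link_faces (V : finType) (e : rel V) (l : nat -> nat) :
  (forall s, s \in cliques e -> #|Lk e s| = l #|s|) ->
  forall (j : nat) (s : {set V}), s \in cliques e ->
    (#|link_faces e s j| * j`! = \prod_(k < j) l (#|s| + k))%N.
Proof.
move=> lE; elim=> [|j IHj] s sc.
  by rewrite link_faces0 // cards1 big_ord0.
rewrite factS mulnA double_count_link_faces big_distrl /= big_ord_recl addn0.
rewrite -lE // -sum_nat_const; apply: eq_bigr => v /setIdP[].
rewrite in_setC => vs vsc; rewrite IHj //; apply: eq_bigr => k _.
by rewrite cardsU1 vs addSnnS.
Qed.

Lemma simplices_flag_completion (V : finType) (e : rel V) (i : nat)
    (s : {set V}) :
  s \in simplices (flag_completion e) i -> s \in cliques e /\ #|s| = i.+1.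
Proof.
rewrite inE in_setU in_set1 => /andP[/predU1P[->|sc] /eqP si] //.
by move: si; rewrite cards0.
Qed.

Theorem lemma4p1 (V : finType) (e : rel V)
    (e_sym : symmetric e) (e_irr : irreflexive e)
    (e_reg : link_regular e) (i : nat)
    (hi : i%:Z <= cdim (flag_completion e))
    (s t : {set V})
    (hs : s \in simplices (flag_completion e) i)
    (ht : t \in simplices (flag_completion e) i) :
  fpoly (Klink (flag_completion e) s) = fpoly (Klink (flag_completion e) t).
Proof.
have [sc si] := simplices_flag_completion hs.
have [tc ti] := simplices_flag_completion ht.
have [l lE] := link_regular_fun e_reg.
congr (1 + _); apply: eq_bigr => j _; rewrite !simplices_Klink //.
congr (_%:R *: _); apply/eqP; rewrite -(eqn_pmul2r (fact_gt0 j.+1)).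
by rewrite !(card_link_faces lE) // si ti.
Qed.
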